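(* Let $D>1$ be real and let $(V,\omega,\mu)$ be the radial path graph with parameter $D$ (defined in the context). For $R\in\mathbb{N}$, $1<p<\infty$ and $w_R:B(0,R)\to[0,\infty)$, consider the Dirichlet problem $$-\Delta_p^\omega u(x)=w_R(x)|u(x)|^{p-2}u(x)\quad (x\in B(0,R)),\qquad u(x)=0\quad (x\in V\setminus B(0,R)).\qquad ( * )$$ (i) If $p>D$, then, for every $\beta<p-D$ and every $C_*>0$, there exists $R_0=R_0(\beta,C_*,p,D)>2$ such that, for every $R\in\mathbb{N}$ with $R\ge R_0$, one can find a nonnegative potential $w_R:B(0,R)\to[0,\infty)$ and a nontrivial solution $u_R\in X_V(B(0,R))$ of $( * )$ such that $$\|w_R\|_{\ell^1(B(0,R),\mu)}<C_*R^{-\beta}.$$ (ii) If $p=D$, then, for every $\beta<p-1$ and every $C_*>0$, there exists $R_0=R_0(\beta,C_*,D)>2$ such that, for every $R\in\mathbb{N}$ with $R\ge R_0$, one can find a nonnegative potential $w_R:B(0,R)\to[0,\infty)$ and a nontrivial solution $u_R\in X_V(B(0,R))$ of $( * )$ such that $$\|w_R\|_{\ell^1(B(0,R),\mu)}<C_*(\log R)^{-\beta}.$$ (iii) If $1<p<D$ and $s>D/p$, then, for every $\beta<p-\frac{D}{s}$ and every $C_*>0$, there exists $R_0=R_0(\beta,C_*,p,D,s)>2$ such that, for every $R\in\mathbb{N}$ with $R\ge R_0$, one can find a nonnegative potential $w_R:B(0,R)\to[0,\infty)$ and a nontrivial solution $u_R\in X_V(B(0,R))$ of $( * )$ such tha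t $$\|w_R\|_{\ell^s(B(0,R),\mu)}<C_*R^{-\beta}.$$
   Context: The radial path graph with parameter $D>1$ has vertex set $V=\mathbb{N}_0=\{0,1,2,\dots\}$, adjacency $m\sim n$ iff $|m-n|=1$, vertex measure $\mu(n)=(n+1)^{D-1}$, and edge weights $\omega_{n,n+1}=\omega_{n+1,n}=(n+1)^{D-1}$ for $n\in\mathbb{N}_0$, all other weights being zero. The graph distance is $|m-n|$, so $B(0,R)=\{0,1,\dots,R\}$ for $R\in\mathbb{N}$ (positive integers). For finite nonempty $\Omega\subset V$, $X_V(\Omega)=\{u:V\to\mathbb{R}:u=0\text{ in }V\setminus\Omega\}$; a solution is nontrivial if it is not identically zero. The discrete $p$-Laplacian is $\Delta_p^\omega u(x)=\frac{1}{\mu(x)}\sum_{y\sim x}\omega_{xy}|u(y)-u(x)|^{p-2}(u(y)-u(x))$, with the convention $|t|^{p-2}t=0$ at $t=0$. For $1\le r<\infty$, $\|f\|_{\ell^r(\Omega,\mu)}=(\sum_{x\in\Omega}\mu(x)|f(x)|^r)^{1/r}$. *)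

(* Defs.v *)
From HB Require Import structures.
From mathcomp Require Import all_boot all_order all_algebra.
From mathcomp Require Import all_classical all_reals all_analysis.
From mathcomp Require Import zify.

Set Implicit Arguments.
Unset Strict Implicit.
Unset Printing Implicit Defensive.

Import Order.TTheory GRing.Theory Num.Theory.

Local Open Scope classical_set_scope.
Local Open Scope ring_scope.

Record weightedGraph (R : realType) := WeightedGraph {
  vertex :> choiceType ;
  adj : rel vertex ;
  edge_weight : vertex -> vertex -> R ;
  vertex_measure : vertex -> R }.

Section WeightedGraph.
Context {R : realType} (G : weightedGraph R).
Implicit Types (Omega : set G) (u w f : G -> R) (p r : R).

(* |t|^(p-2) t; the second factor makes it vanish at t = 0 whatever the value
   of 0 `^ (p - 2). *)
Definition signed_pow p (t : R) : R := `|t| `^ (p - 2) * t.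

(* \sum_(_ \in _) is the finitely supported sum, and is 0 on infinite supports:
   the following is only meaningful on locally finite graphs. *)
Definition pLaplacian p u (x : G) : R :=
  (vertex_measure x)^-1 *
  \sum_(y \in [set y | adj x y]) edge_weight x y * signed_pow p (u y - u x).

Definition vanishing_outside Omega : set (G -> R) :=
  [set u | forall x, ~ Omega x -> u x = 0].

Definition dirichlet_solution p Omega w u : Prop :=
  vanishing_outside Omega u /\
  forall x, Omega x -> - pLaplacian p u x = w x * signed_pow p (u x).

Definition nontrivial u : Prop := exists x, u x != 0.

(* Omega is meant to be finite, and only the values of f on Omega matter. *)
Definition lnorm r Omega f : R :=
  (\sum_(x \in Omega) vertex_measure x * `|f x| `^ r) `^ r^-1.

End WeightedGraph.

Section RadialPath.
Context {R : realType} (D : R).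

Definition path_dist (m n : nat) : nat := `|m%:Z - n%:Z|%N.

Definition path_adj : rel nat := [rel m n | path_dist m n == 1%N].

(* minn m n is the endpoint of the edge {m, n} closest to 0. *)
Definition path_weight (m n : nat) : R :=
  if path_adj m n then (minn m n).+1%:R `^ (D - 1) else 0.

Definition path_measure (n : nat) : R := n.+1%:R `^ (D - 1).

Definition radial_path : weightedGraph R :=
  WeightedGraph path_adj path_weight path_measure.

Definition path_ball (x N : nat) : set radial_path :=
  [set y : nat | (path_dist x y <= N)%N].

Lemma path_ball0E (N : nat) : path_ball 0 N = [set n : nat | (n <= N)%N].
Proof.
by apply/seteqP; split => n /=; rewrite /path_ball /path_dist /= sub0r abszN.
Qed.

Lemma path_adjE (m n : nat) : path_adj m n = (n == m.+1) || (m == n.+1).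
Proof. by rewrite /path_adj /path_dist /=; apply/idP/idP; lia. Qed.

Lemma path_weightS (n : nat) : path_weight n n.+1 = n.+1%:R `^ (D - 1).
Proof.
rewrite /path_weight path_adjE eqxx /=.
by congr ((_.+1)%:R `^ _); apply/minn_idPl.
Qed.

Lemma path_weightC (m n : nat) : path_weight m n = path_weight n m.
Proof. by rewrite /path_weight !path_adjE minnC orbC. Qed.

Lemma finite_path_neighbours (m : nat) : finite_set [set n | path_adj m n].
Proof.
apply: (@sub_finite_set _ _ `I_m.+2); last exact: finite_II.
by move=> n /=; rewrite path_adjE; lia.
Qed.

Lemma finite_path_ball0 (N : nat) : finite_set (path_ball 0 N).
Proof. by rewrite path_ball0E; exact: (finite_II N.+1). Qed.

End RadialPath.

Arguments path_ball {R} D x N.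

(* Main.v *)
Require Import Defs.
From HB Require Import structures.
From mathcomp Require Import all_boot all_order all_algebra.
From mathcomp Require Import all_classical all_reals all_analysis.
From mathcomp Require Import zify ring lra.

Set Implicit Arguments.
Unset Strict Implicit.
Unset Printing Implicit Defensive.

(** On a path, a radially decreasing function is determined by its flux: if
  [Phi k > 0] is the flux [omega_{k,k+1} (u k - u k.+1)^(p-1)] across the edge
  [{k, k+1}], then [u] is recovered by summing the slopes
  [(Phi k / mu k)^(1/(p-1))] from [n] to the boundary, since
  [omega_{k,k+1} = mu k], and [- Delta_p u] is the discrete derivative of [Phi]
  divided by [mu] ([pLaplacian_flux_potential]). Any positive [u] solves the
  Dirichlet problem with [w = - Delta_p u / u^(p-1)], so it suffices to choose
  the flux well.

  The choice is [- Delta_p u = 1] on the inner ball [B(0,m)] and [0] on the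
  rest of [B(0,N)], that is [Phi k = mu (B(0, min k m))]. The potential
  [w = u^(1-p)] then lives on [B(0,m)] only, away from the boundary where [u]
  is small. There, [u] is bounded below by its drop from [m] to [N+1], along
  which the flux has the constant value [F = mu (B(0,m))], so that
  [u >= F^(1/(p-1)) T] with [T = \sum_(m <= k <= N) mu k^(-1/(p-1))], and hence
  [||w||_s <= F^(1/s-1) T^(1-p)] ([lnorm_torsion_weight_le]).

  With [m] about [N/2], the quantities [F] and [T] are at least constants
  times [N^D] and [N^(1-(D-1)/(p-1))], which gives the rate [N^(D/s-p)] whenever
  [s >= 1] and [D/s < p] ([lnorm_torsion_weight_half]). For [p > D] this is used
  with [s = 1], and for [p < D] with the given [s > D/p > 1]. When [p = D] and
  [s = 1] that rate degenerates to a constant; the logarithm appears on taking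
  [m = 0] instead, for which [F = 1] and [T] is the harmonic sum
  ([lnorm_torsion_weight0]). In each case the rate obtained is the endpoint
  one, up to a constant that a smaller exponent [beta] absorbs ([powR_decay]).
*)

Import Order.TTheory GRing.Theory Num.Theory.

Local Open Scope classical_set_scope.
Local Open Scope ring_scope.

(** * Real powers and the harmonic sum *)

Section Powers.
Context {R : realType}.
Implicit Types x y a b e : R.

Lemma ler_powR_neg x y e : e <= 0 -> 0 < x -> x <= y -> y `^ e <= x `^ e.
Proof.
move=> e0 x0 xy; have y0 := lt_le_trans x0 xy.
rewrite -[e]opprK !(powRN _ (- e)) lef_pV2 ?posrE ?powR_gt0//.
by rewrite ge0_ler_powR ?nnegrE ?oppr_ge0// ltW.
Qed.

Lemma powRVK x e : 0 <= x -> e != 0 -> (x `^ e^-1) `^ e = x.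
Proof. by move=> x0 e0; rewrite -powRrM mulVf// powRr1. Qed.

Lemma powR_mulD x a b : 0 < x -> x `^ a * x `^ b = x `^ (a + b).
Proof. by move=> x0; rewrite powRD// (gt_eqF x0) implybT. Qed.

Lemma powRVl x e : 0 <= x -> x^-1 `^ e = x `^ (- e).
Proof. by move=> x0; rewrite -powR_inv1// -powRrM mulN1r. Qed.

(** This absorbs both the constant [K] of an estimate and the prescribed constant
  [C] into the gap between the exponents, for [x] large. *)
Lemma powR_decay (K C e b : R) : 0 < K -> 0 < C -> b < e ->
  exists X : R, forall x, X < x -> K * x `^ (- e) < C * x `^ (- b).
Proof.
move=> K0 C0 be; have eb : 0 < e - b by rewrite subr_gt0.
exists ((K / C) `^ (e - b)^-1).
move=> x Xx; have x0 : 0 < x by apply: le_lt_trans Xx; exact: powR_ge0.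
have KC : K / C < x `^ (e - b).
  rewrite -[ltLHS](@powRVK _ (e - b)) ?gt_eqF//; last first.
    by rewrite ltW// divr_gt0.
  by rewrite gt0_ltr_powR// nnegrE ?powR_ge0 ?ltW.
rewrite (_ : - b = (e - b) + - e); last by ring.
rewrite -powR_mulD// mulrA ltr_pM2r ?powR_gt0//.
by rewrite mulrC -ltr_pdivrMr.
Qed.

(** Induction on [n]: the increment of [ln] from [n + 1] to [n + 2] is
  [ln (1 + 1 / (n + 1)) <= 1 / (n + 1)]. *)
Lemma ln_le_harmonic n : ln n.+1%:R <= \sum_(0 <= k < n) k.+1%:R^-1 :> R.
Proof.
elim: n => [|n IHn]; first by rewrite ln1 big_nil.
rewrite big_nat_recr//=.
have n1 : n.+1%:R != 0 :> R by rewrite pnatr_eq0.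
rewrite (_ : n.+2%:R = n.+1%:R * (1 + n.+1%:R^-1)); last first.
  by rewrite mulrDr mulfV// mulr1 -[in LHS]natr1.
rewrite lnM ?posrE ?addr_gt0// lerD// le_ln1Dx//.
by rewrite (lt_trans (ltrN10 _))// invr_gt0.
Qed.

End Powers.

(** * The p-Laplacian on the radial path *)

Section Solutions.
Context {R : realType} (D p : R).
Implicit Types (u : radial_path D -> R) (m n k N : nat).

Let mu := path_measure D.

Lemma path_measure_gt0 n : 0 < mu n.
Proof. by rewrite powR_gt0. Qed.

Lemma signed_pow_gt0 (t : R) : 0 < t -> signed_pow p t = t `^ (p - 1).
Proof.
move=> t0; rewrite /signed_pow gtr0_norm// -[X in _ * X]powRr1 ?ltW//.
by rewrite powR_mulD//; congr (_ `^ _); ring.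
Qed.

Lemma signed_powN (t : R) : signed_pow p (- t) = - signed_pow p t.
Proof. by rewrite /signed_pow normrN mulrN. Qed.

Lemma pLaplacian_path0 u :
  pLaplacian p u 0%N = (mu 0)^-1 * (mu 0 * signed_pow p (u 1%N - u 0%N)).
Proof.
rewrite /pLaplacian.
rewrite (_ : [set y | adj _ y] = [set (1%N : radial_path D)]); last first.
  by apply/seteqP; split => y /=; rewrite path_adjE; lia.
by rewrite fsbig_set1 /= path_weightS.
Qed.

Lemma pLaplacian_pathS u n :
  pLaplacian p u n.+1 = (mu n.+1)^-1 *
   (mu n.+1 * signed_pow p (u n.+2 - u n.+1) +
    mu n * signed_pow p (u n - u n.+1)).
Proof.
rewrite /pLaplacian.
rewrite (_ : [set y | adj _ y] =
  [set (n.+2 : radial_path D)] `|` [set (n : radial_path D)]); last first.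
  by apply/seteqP; split => y /=; rewrite path_adjE; lia.
rewrite fsbigU0 ?fsbig_set1 /=; last 3 first.
- exact: finite_set1.
- exact: finite_set1.
- by move=> y /= [-> /esym]; lia.
by rewrite path_weightS path_weightC path_weightS.
Qed.

Lemma sum_path_ball0 (f : radial_path D -> R) N :
  \sum_(n \in path_ball D 0 N) f n = \sum_(0 <= n < N.+1) f n.
Proof.
rewrite path_ball0E (big_mkord xpredT).
exact/esym/(@fsbig_ord _ _ _ N.+1 (f : nat -> R)).
Qed.

(** * Functions with a prescribed flux *)

Hypothesis hp : 1 < p.

Let p1_gt0 : 0 < p - 1. Proof. by rewrite subr_gt0. Qed.

(** The function vanishing beyond [N] whose flux across the edge [{k, k+1}] is
  [Phi k] for every [k <= N]; an empty sum provides the boundary condition. *)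
Definition flux_potential (Phi : nat -> R) N n : R :=
  \sum_(n <= k < N.+1) (Phi k / mu k) `^ (p - 1)^-1.

Section FluxPotential.
Variables (Phi : nat -> R) (N : nat).
Hypothesis Phi_gt0 : forall k, 0 < Phi k.

Let slope_gt0 k : 0 < (Phi k / mu k) `^ (p - 1)^-1.
Proof. by rewrite powR_gt0// divr_gt0// path_measure_gt0. Qed.

Lemma flux_potential_gt0 n : (n <= N)%N -> 0 < flux_potential Phi N n.
Proof.
move=> nN; rewrite /flux_potential big_ltn// ltr_pwDl// sumr_ge0// => k _.
exact: ltW.
Qed.

Lemma flux_potential_out n : (N < n)%N -> flux_potential Phi N n = 0.
Proof. by move=> Nn; rewrite /flux_potential big_geq. Qed.

Lemma flux_potentialB n : (n <= N)%N ->
  mu n * signed_pow p (flux_potential Phi N n - flux_potential Phi N n.+1) =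
  Phi n.
Proof.
move=> nN; rewrite [X in X - _]/flux_potential big_ltn// addrK signed_pow_gt0//.
rewrite powRVK ?gt_eqF//; last first.
  by rewrite divr_ge0 ?ltW// path_measure_gt0.
by rewrite mulrC divfK// gt_eqF// path_measure_gt0.
Qed.

(** Discrete Gauss formula: what is produced at [n] is the outgoing flux minus
  the incoming one, the origin having no incoming flux. *)
Lemma pLaplacian_flux_potential n : (n <= N)%N ->
  - pLaplacian p (flux_potential Phi N : radial_path D -> R) n =
  (if n is k.+1 then Phi n - Phi k else Phi n) / mu n.
Proof.
move=> nN; have := flux_potentialB nN.
rewrite -opprB signed_powN mulrN => /eqP.
rewrite eqr_oppLR => /eqP flux.
case: n nN flux => [|n] nN flux.
  by rewrite pLaplacian_path0 flux mulrN opprK mulrC.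
rewrite pLaplacian_pathS flux (flux_potentialB (ltnW nN)).
by rewrite -mulrN opprD opprK mulrC.
Qed.

End FluxPotential.

(** * Unit load on an inner ball *)

(** By the Gauss formula, [- Delta_p u = 1] on [B(0,m)] and [0] further out
  means that the flux leaving [B(0,k)] is the measure of [B(0, min k m)]. *)
Definition load_flux m k : R := \sum_(0 <= j < (minn k m).+1) mu j.

Lemma load_flux_gt0 m k : 0 < load_flux m k.
Proof.
rewrite /load_flux big_nat_recl// ltr_pwDl ?path_measure_gt0// sumr_ge0// => j _.
by rewrite ltW ?path_measure_gt0.
Qed.

(** For [m = N] this is the torsion function of [B(0,N)], which solves
  [- Delta_p u = 1]. Taking [m < N] keeps the load away from the boundary, where
  dividing by a small [u^(p-1)] would make the potential large. *)
Definition torsion m N : radial_path D -> R := flux_potential (load_flux m) N.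

Definition torsion_weight m N : radial_path D -> R :=
  fun n => if (n <= m)%N then torsion m N n `^ (1 - p) else 0.

Lemma pLaplacian_torsion m N n : (n <= N)%N ->
  - pLaplacian p (torsion m N) n = (n <= m)%N%:R.
Proof.
move=> nN; rewrite pLaplacian_flux_potential//; last exact: load_flux_gt0.
have mu0 k : mu k != 0 by rewrite gt_eqF ?path_measure_gt0.
case: n nN => [|n] nN; first by rewrite /load_flux min0n big_nat1 divff.
rewrite /= /load_flux; case: (ltnP n m) => nm.
  rewrite (minn_idPl nm).
  by rewrite [X in X - _]big_nat_recr//= addrAC subrr add0r divff.
by rewrite (minn_idPr (leqW nm)) subrr mul0r.
Qed.

Lemma torsion_solution m N :
  dirichlet_solution p (path_ball D 0 N) (torsion_weight m N) (torsion m N).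
Proof.
rewrite path_ball0E; split=> [n /= /negP|n /= nN].
  by rewrite -ltnNge; exact: flux_potential_out.
have u0 : 0 < torsion m N n.
  by apply: flux_potential_gt0 => // k; exact: load_flux_gt0.
rewrite pLaplacian_torsion// /torsion_weight.
case: ifP => _; last by rewrite mul0r.
rewrite signed_pow_gt0// powR_mulD// (_ : 1 - p + (p - 1) = 0); last by ring.
by rewrite powRr0.
Qed.

Lemma torsion_nontrivial m N : nontrivial (torsion m N).
Proof.
exists 0%N; rewrite gt_eqF//.
by apply: flux_potential_gt0 => // k; exact: load_flux_gt0.
Qed.

Lemma torsion_weight_ge0 m N n : 0 <= torsion_weight m N n.
Proof. by rewrite /torsion_weight; case: ifP => // _; exact: powR_ge0. Qed.

(** The [p]-resistance of the path from [m] to [N + 1]: the potential drop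
  that a unit flux produces between these two points. *)
Definition resistance m N : R := \sum_(m <= k < N.+1) mu k `^ (- (p - 1)^-1).

Lemma resistance_gt0 m N : (m <= N)%N -> 0 < resistance m N.
Proof.
move=> mN; rewrite /resistance big_ltn// ltr_pwDl//.
  by rewrite powR_gt0// path_measure_gt0.
by rewrite sumr_ge0// => k _; exact: powR_ge0.
Qed.

(** [torsion m N] decreases, and from [m] on its flux is constant, so
  its drop from [m] to the boundary is given by the resistance. *)
Lemma torsion_ge m N n : (n <= m)%N -> (m <= N)%N ->
  load_flux m m `^ (p - 1)^-1 * resistance m N <= torsion m N n.
Proof.
move=> nm mN; rewrite /torsion /flux_potential.
rewrite (@big_cat_nat _ _ _ m)//=; last exact: leqW.
apply: ler_wpDl; first by apply: sumr_ge0 => k _; exact: powR_ge0.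
rewrite mulr_sumr; apply: ler_sum_nat => k /andP[mk _].
have -> : load_flux m k = load_flux m m.
  by rewrite /load_flux minnn (minn_idPr _).
rewrite powRM ?invr_ge0 ?(ltW (load_flux_gt0 _ _))
  ?(ltW (path_measure_gt0 _))//.
by rewrite powRVl// ltW// path_measure_gt0.
Qed.

Lemma torsion_weight_le m N n : (n <= m)%N -> (m <= N)%N ->
  torsion_weight m N n <= (load_flux m m)^-1 * resistance m N `^ (1 - p).
Proof.
move=> nm mN; rewrite /torsion_weight nm.
have F0 := load_flux_gt0 m m; have T0 := resistance_gt0 mN.
apply: le_trans (ler_powR_neg _ _ (torsion_ge nm mN)) _.
- by rewrite subr_le0 ltW.
- by rewrite mulr_gt0// powR_gt0.
rewrite powRM ?powR_ge0 ?(ltW T0)// -[1 - p]opprB [X in X * _]powRN.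
by rewrite powRVK ?gt_eqF ?(ltW F0).
Qed.

(** The weight is at most [F^-1 T^(1-p)] on [B(0,m)], a set of measure [F], and
  vanishes elsewhere; here [F] and [T] are the flux and the resistance. *)
Lemma lnorm_torsion_weight_le m N s : (m <= N)%N -> 0 < s ->
  lnorm s (path_ball D 0 N) (torsion_weight m N) <=
  load_flux m m `^ (s^-1 - 1) * resistance m N `^ (1 - p).
Proof.
move=> mN s0; have F0 := load_flux_gt0 m m; have T0 := resistance_gt0 mN.
set A := (load_flux m m)^-1 * resistance m N `^ (1 - p).
have A0 : 0 <= A by rewrite mulr_ge0 ?powR_ge0 ?invr_ge0 ?ltW.
have -> : load_flux m m `^ (s^-1 - 1) * resistance m N `^ (1 - p) =
          (load_flux m m * A `^ s) `^ s^-1.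
  rewrite powRM ?powR_ge0 ?ltW// -powRrM mulfV ?gt_eqF// powRr1// mulrA.
  by rewrite -powR_mulD// powR_inv1 ?(ltW F0).
rewrite /lnorm ge0_ler_powR ?invr_ge0 ?nnegrE ?(ltW s0)//.
- rewrite fsumr_ge0// => n _.
  by rewrite mulr_ge0 ?powR_ge0.
- by rewrite mulr_ge0 ?powR_ge0 ?ltW.
rewrite sum_path_ball0.
rewrite (@big_cat_nat _ _ _ m.+1)//=.
rewrite [X in _ + X](_ : _ = 0) ?addr0; last first.
  rewrite big_nat_cond big1// => n; rewrite andbT => /andP[mn _].
  by rewrite /torsion_weight leqNgt mn normr0 powR0 ?mulr0 ?gt_eqF.
rewrite /load_flux minnn mulr_suml; apply: ler_sum_nat => n /andP[_ nm].
rewrite ler_wpM2l ?(ltW (path_measure_gt0 _))//.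
rewrite ger0_norm ?torsion_weight_ge0//.
rewrite ge0_ler_powR ?nnegrE ?torsion_weight_ge0 ?(ltW s0)//.
exact: torsion_weight_le.
Qed.

(** * Decay rates *)

Hypothesis hD : 1 < D.

Let D1_ge0 : 0 <= D - 1. Proof. by rewrite subr_ge0 ltW. Qed.

(** The upper half of the terms suffices: there are at least [(m + 1) / 2] of
  them, each at least [((m + 1) / 2)^(D-1)]. *)
Lemma load_flux_ge m : (m.+1%:R / 2) `^ D <= load_flux m m.
Proof.
set h : R := m.+1%:R / 2; have h0 : 0 < h by rewrite divr_gt0.
have hh : h + h = m.+1%:R by rewrite /h; field.
have half_le : (m.+1./2)%:R <= h.
  by rewrite -(@ler_pM2r _ 2)// divfK// -natrM ler_nat; lia.
have le_half : h <= (m.+1./2).+1%:R.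
  by rewrite -(@ler_pM2r _ 2)// divfK// -natrM ler_nat; lia.
rewrite /load_flux minnn (@big_cat_nat _ _ _ m.+1./2)//=; last by lia.
apply: ler_wpDl; first by rewrite sumr_ge0// => j _; exact: powR_ge0.
apply: (@le_trans _ _ (\sum_(m.+1./2 <= j < m.+1) h `^ (D - 1))).
  rewrite sumr_const_nat -mulr_natl natrB; last by lia.
  have <- : h * h `^ (D - 1) = h `^ D.
    by rewrite -{1}[h]powRr1 ?(ltW h0)// powR_mulD// addrC subrK.
  by rewrite ler_wpM2r ?powR_ge0// lerBrDr -hh lerD2l.
apply: ler_sum_nat => j /andP[mj _]; rewrite /mu /path_measure.
rewrite ge0_ler_powR ?nnegrE ?(ltW h0)//.
by rewrite (le_trans le_half)// ler_nat.
Qed.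

Lemma resistance_ge m N :
  (N.+1 - m)%:R * mu N `^ (- (p - 1)^-1) <= resistance m N.
Proof.
rewrite /resistance mulr_natl -sumr_const_nat.
apply: ler_sum_nat => k /andP[_ kN].
rewrite ler_powR_neg ?path_measure_gt0 ?oppr_le0 ?invr_ge0 ?(ltW p1_gt0)//.
by rewrite ge0_ler_powR ?nnegrE// ler_nat.
Qed.

(** Both [B(0,N/2)] and its complement in [B(0,N)] have size comparable to [N],
  so flux and resistance are bounded below by powers of [N + 1]; these enter
  with the nonpositive exponents [1/s - 1] and [1 - p], which combine to
  [D (1/s - 1) + (D - p) = - (p - D/s)]. *)
Lemma lnorm_torsion_weight_half s : 1 <= s -> D / s < p ->
  exists2 K : R, 0 < K & forall N, (0 < N)%N ->
    lnorm s (path_ball D 0 N) (torsion_weight N./2 N) <=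
    K * N%:R `^ (- (p - D / s)).
Proof.
move=> s1 Dsp; have s0 : 0 < s := lt_le_trans ltr01 s1.
exists (4^-1 `^ (D * (s^-1 - 1)) * 2^-1 `^ (1 - p)).
  by rewrite mulr_gt0// powR_gt0.
move=> N N0; set m := N./2; have mN : (m <= N)%N by rewrite /m; lia.
have le_2m : (N.+1 <= m.+1 * 2)%N by rewrite /m; lia.
have le_2Nm : (N.+1 <= (N.+1 - m) * 2)%N by rewrite /m; lia.
set x : R := N.+1%:R; have x0 : 0 < x by [].
have x_ge0 := ltW x0; have p1_neq0 : p - 1 != 0 by rewrite gt_eqF.
have flux_ge : (4^-1 * x) `^ D <= load_flux m m.
  apply: le_trans (load_flux_ge m).
  rewrite ge0_ler_powR ?nnegrE ?mulr_ge0 ?(le_trans ler01 (ltW hD))//.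
  by move: le_2m; rewrite -(ler_nat R) natrM -/x; lra.
have resistance_ge' : 2^-1 * x `^ (1 - (D - 1) / (p - 1)) <= resistance m N.
  apply: le_trans (resistance_ge m N).
  rewrite /mu /path_measure -/x -powRrM -powR_mulD// powRr1// mulrA mulrN.
  rewrite ler_wpM2r ?powR_ge0//.
  by move: le_2Nm; rewrite -(ler_nat R) natrM -/x; lra.
apply: le_trans (lnorm_torsion_weight_le mN s0) _.
have flux_le : load_flux m m `^ (s^-1 - 1) <=
    4^-1 `^ (D * (s^-1 - 1)) * x `^ (D * (s^-1 - 1)).
  rewrite -powRM// powRrM ler_powR_neg ?powR_gt0 ?mulr_gt0//.
  by rewrite subr_le0 invf_le1.
have resistance_le : resistance m N `^ (1 - p) <=
    2^-1 `^ (1 - p) * x `^ (D - p).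
  have -> : D - p = (1 - (D - 1) / (p - 1)) * (1 - p) by field.
  rewrite powRrM -powRM ?powR_ge0// ler_powR_neg ?mulr_gt0 ?powR_gt0//.
  by rewrite subr_le0 ltW.
apply: le_trans (ler_pM _ _ flux_le resistance_le) _; rewrite ?powR_ge0//.
rewrite mulrACA ler_wpM2l ?mulr_ge0 ?powR_ge0// powR_mulD//.
rewrite (_ : _ + _ = - (p - D / s)); last by ring.
rewrite ler_powR_neg ?ltr0n ?ler_nat//.
by rewrite oppr_le0 subr_ge0 ltW.
Qed.

(** In the critical case every slope exponent [(D-1)/(p-1)] equals [1], so the
  resistance of the whole ball is a harmonic sum; loading the origin alone,
  of measure [1], exploits all of it. *)
Lemma lnorm_torsion_weight0 N : p = D ->
  lnorm 1 (path_ball D 0 N) (torsion_weight 0 N) <=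
  (\sum_(0 <= k < N.+1) k.+1%:R^-1) `^ (- (p - 1)).
Proof.
move=> pD; apply: le_trans (lnorm_torsion_weight_le (leq0n N) ltr01) _.
rewrite invr1 subrr powRr0 mul1r opprB /resistance.
rewrite (eq_bigr (fun k => k.+1%:R^-1))// => k _.
rewrite /mu /path_measure -pD -powRrM mulrN mulfV ?gt_eqF//.
by rewrite powR_inv1.
Qed.

End Solutions.

Theorem proposition3p15 (R : realType) (D p : R) (hD : 1 < D) (hp : 1 < p) :
  [/\ D < p ->
      forall beta C : R, beta < p - D -> 0 < C ->
      exists R0 : R, 2 < R0 /\
      forall N : nat, R0 <= N%:R ->
      exists w u : radial_path D -> R,
        [/\ forall x, path_ball D 0 N x -> 0 <= w x,
            dirichlet_solution p (path_ball D 0 N) w u,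
            nontrivial u &
            lnorm 1 (path_ball D 0 N) w < C * N%:R `^ (- beta)],
      p = D ->
      forall beta C : R, beta < p - 1 -> 0 < C ->
      exists R0 : R, 2 < R0 /\
      forall N : nat, R0 <= N%:R ->
      exists w u : radial_path D -> R,
        [/\ forall x, path_ball D 0 N x -> 0 <= w x,
            dirichlet_solution p (path_ball D 0 N) w u,
            nontrivial u &
            lnorm 1 (path_ball D 0 N) w < C * (ln N%:R) `^ (- beta)] &
      p < D ->
      forall s : R, D / p < s ->
      forall beta C : R, beta < p - D / s -> 0 < C ->
      exists R0 : R, 2 < R0 /\
      forall N : nat, R0 <= N%:R ->
      exists w u : radial_path D -> R,
        [/\ forall x, path_ball D 0 N x -> 0 <= w x,
            dirichlet_solution p (path_ball D 0 N) w u,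
            nontrivial u &
            lnorm s (path_ball D 0 N) w < C * N%:R `^ (- beta)]].
Proof.
have rate_case s : 1 <= s -> D / s < p ->
    forall beta C : R, beta < p - D / s -> 0 < C ->
    exists R0 : R, 2 < R0 /\ forall N : nat, R0 <= N%:R ->
    exists w u : radial_path D -> R,
      [/\ forall x, path_ball D 0 N x -> 0 <= w x,
          dirichlet_solution p (path_ball D 0 N) w u,
          nontrivial u &
          lnorm s (path_ball D 0 N) w < C * N%:R `^ (- beta)].
  move=> s1 Dsp beta C hbeta C0.
  have [K K0 hK] := lnorm_torsion_weight_half hp hD s1 Dsp.
  have [X hX] := powR_decay K0 C0 hbeta.
  exists (3 + `|X|); split=> [|N hN]; first by rewrite ltr_wpDr// ltr_nat.
  exists (torsion_weight p N./2 N), (torsion p N./2 N); split.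
  - by move=> n _; exact: torsion_weight_ge0.
  - exact: torsion_solution.
  - exact: torsion_nontrivial.
  apply: le_lt_trans (hK _ _) (hX _ _).
  - by rewrite -(ltr_nat R) (lt_le_trans _ hN)// ltr_wpDr.
  - by rewrite (lt_le_trans _ hN)//; have := ler_norm X; lra.
split=> [pD beta C|pD beta C hbeta C0|pD s hs beta C].
(* For [s = 1] the two conditions [1 <= s] and [D / s < p] reduce to [D < p]. *)
- have := @rate_case 1 (lexx 1); rewrite divr1 => H; exact: H.
- have [X hX] := powR_decay ltr01 C0 hbeta.
  (* [powR_decay] is applied at [ln N], which exceeds [X] once [N > expR X]. *)
  exists (3 + expR X); split=> [|N hN].
    by rewrite ltr_wpDr ?expR_ge0// ltr_nat.
  have X3 : 3 < N%:R :> R by rewrite (lt_le_trans _ hN)// ltrDl expR_gt0.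
  have N0 : 0 < N%:R :> R by rewrite (lt_trans _ X3).
  have lnX : X < ln N%:R.
    by rewrite -[X]expRK ltr_ln ?posrE ?expR_gt0//; lra.
  have lnN0 : 0 < ln N%:R :> R by rewrite ln_gt0//; lra.
  exists (torsion_weight p 0 N), (torsion p 0 N); split.
  - by move=> n _; exact: torsion_weight_ge0.
  - exact: torsion_solution.
  - exact: torsion_nontrivial.
  apply: le_lt_trans (lnorm_torsion_weight0 hp N pD) _.
  apply: le_lt_trans _ (hX _ lnX); rewrite mul1r ler_powR_neg//.
    by rewrite oppr_le0 subr_ge0 ltW.
  apply: le_trans (ln_le_harmonic N.+1).
  by rewrite ler_ln ?posrE ?ler_nat// ltnW.
- have p0 : 0 < p := lt_trans ltr01 hp.
  have s1 : 1 < s by apply: lt_trans hs; rewrite ltr_pdivlMr ?mul1r.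
  apply: rate_case; first exact: ltW.
  by rewrite ltr_pdivrMr ?(lt_trans ltr01 s1)// mulrC -ltr_pdivrMr.
Qed.
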